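(* Let $A_{R_{(1,m)}}=\mathbb{F}Q/I$, where $Q$ is the linearly oriented quiver $1\to2\to\cdots\to n$ with arrows $\alpha_i:i\to i+1$ and $I$ is the ideal generated by the single relation $R=\alpha_1\alpha_2\cdots\alpha_m$ of length $m$ starting at vertex $1$, where $2\le m\le n-1$. Then the number of exceptional pairs of $A_{R_{(1,m)}}$ is \[ \frac{1}{6}\Bigl(4m^3-3m^2(2n+1)+m(6n^2-1)+(n-2)(n-1)n^2\Bigr). \]
   Context: $\mathbb{F}$ is an algebraically closed field and $n\ge 3$. Modules are finite-dimensional and identified with finite-dimensional representations of $Q$ (linear maps $V_i\to V_{i+1}$) satisfying the relations in $I$. A pair $(M,N)$ of $A$-modules is an exceptional pair if $\operatorname{Hom}_A(N,M)\cong 0$ and $\operatorname{Ext}^i_A(N,M)\cong 0$ for all $i\ge 1$. The number of exceptional pairs is the number of ordered pairs $(M,N)$ of isomorphism classes of indecomposable modules that are exceptional pairs. *)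

(* Defs.v *)
From HB Require Import structures.
From mathcomp Require Import all_boot all_order all_algebra.

Set Implicit Arguments.
Unset Strict Implicit.
Unset Printing Implicit Defensive.

Import Order.TTheory GRing.Theory Num.Theory.
Local Open Scope ring_scope.

Record quiver := Quiver {
  vertex :> Type;
  arrow : vertex -> vertex -> Type
}.

(* Paths are written in the order in which their arrows are traversed. *)
Inductive qpath (Q : quiver) : Q -> Q -> Type :=
| qpath_nil (i : Q) : qpath i i
| qpath_cons (i j k : Q) : arrow i j -> qpath j k -> qpath i k.

Fixpoint qlength (Q : quiver) (i j : Q) (p : qpath i j) : nat :=
  match p with
  | qpath_nil _ => 0%N
  | qpath_cons _ _ _ _ q => (qlength q).+1
  end.

(* A set of paths of Q, regarded as generators of a (monomial) ideal of the
   path algebra. *)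
Definition relations (Q : quiver) := forall i j : Q, qpath i j -> Prop.

Fixpoint path_map (F : fieldType) (Q : quiver) (V : Q -> vectType F)
    (f : forall i j : Q, arrow i j -> 'Hom(V i, V j)) (i j : Q)
    (p : qpath i j) : 'Hom(V i, V j) :=
  match p in qpath i j return 'Hom(V i, V j) with
  | qpath_nil _ => \1%VF
  | qpath_cons _ _ _ a q => (path_map f q \o f _ _ a)%VF
  end.

(* Finite-dimensional modules over FQ/I, with I the ideal generated by R, as
   representations of Q; the relations in I hold as soon as the generators act
   by zero. *)
Record module (F : fieldType) (Q : quiver) (R : relations Q) := Module {
  space :> Q -> vectType F;
  act : forall i j : Q, arrow i j -> 'Hom(space i, space j);
  act_rel : forall (i j : Q) (p : qpath i j), R i j p -> path_map act p = 0
}.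

Section Modules.
Variables (F : fieldType) (Q : quiver) (R : relations Q).
Implicit Types M N P X Y : module F R.

Record hom M N := Hom {
  hom_fun :> forall v : Q, 'Hom(M v, N v);
  hom_nat : forall (i j : Q) (a : arrow i j),
    (hom_fun j \o act M a)%VF = (act N a \o hom_fun i)%VF
}.

Definition surjective M N (f : hom M N) : Prop :=
  forall v : Q, limg (f v) = fullv.

Definition isomorphic M N : Prop :=
  exists (f : hom M N) (g : hom N M), forall v : Q,
    (g v \o f v)%VF = \1%VF /\ (f v \o g v)%VF = \1%VF.

Definition zero_module M : Prop := forall v : Q, \dim {: M v} = 0%N.

Definition submodule M (U : forall v : Q, {vspace M v}) : Prop :=
  forall (i j : Q) (a : arrow i j), (act M a @: U i <= U j)%VS.

Definition indecomposable M : Prop :=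
  ~ zero_module M /\
  forall U W : forall v : Q, {vspace M v},
    submodule U -> submodule W ->
    (forall v : Q, (U v + W v)%VS = fullv /\ (U v :&: W v)%VS = 0%VS) ->
    (forall v : Q, U v = 0%VS) \/ (forall v : Q, W v = 0%VS).

Definition projective P : Prop :=
  forall X Y (e : hom X Y) (f : hom P Y), surjective e ->
    exists g : hom P X, forall v : Q, (e v \o g v)%VF = f v.

Record projective_resolution N := ProjectiveResolution {
  term :> nat -> module F R;
  diff : forall k : nat, hom (term k.+1) (term k);
  aug : hom (term 0%N) N;
  term_projective : forall k : nat, projective (term k);
  aug_surjective : surjective aug;
  exact_aug : forall v : Q, limg (diff 0%N v) = lker (aug v);
  exact_diff : forall (k : nat) (v : Q),
    limg (diff k.+1 v) = lker (diff k v)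
}.

Definition cocycle N M (P : projective_resolution N) (i : nat)
    (f : hom (P i) M) : Prop :=
  forall v : Q, (f v \o diff P i v)%VF = 0.

Definition coboundary N M (P : projective_resolution N) (i : nat) :
    hom (P i) M -> Prop :=
  match i return hom (P i) M -> Prop with
  | 0%N => fun f => forall v : Q, f v = 0
  | k.+1 => fun f => exists g : hom (P k) M,
      forall v : Q, f v = (g v \o diff P k v)%VF
  end.

(* Ext^i(N, M) = 0, i.e. H^i(Hom(P, M)) = 0 for a projective resolution P of N;
   this does not depend on the choice of P. *)
Definition Ext_zero (i : nat) N M : Prop :=
  exists P : projective_resolution N,
    forall f : hom (P i) M, cocycle f -> coboundary f.

Definition Hom_zero N M : Prop :=
  forall (f : hom N M) (v : Q), f v = 0.

Definition exceptional_pair M N : Prop :=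
  Hom_zero N M /\ forall i : nat, (1 <= i)%N -> Ext_zero i N M.

(* There are exactly k ordered pairs of isomorphism classes of indecomposable
   modules which are exceptional pairs: r lists representatives of them. *)
Definition number_of_exceptional_pairs (k : nat) : Prop :=
  exists r : 'I_k -> module F R * module F R,
    [/\ forall a : 'I_k,
          [/\ indecomposable (r a).1, indecomposable (r a).2
            & exceptional_pair (r a).1 (r a).2],
        forall a b : 'I_k,
          isomorphic (r a).1 (r b).1 -> isomorphic (r a).2 (r b).2 -> a = b
      & forall M N, indecomposable M -> indecomposable N ->
          exceptional_pair M N ->
          exists a : 'I_k, isomorphic M (r a).1 /\ isomorphic N (r a).2].

End Modules.

(* Vertices are numbered from 0: the element i of 'I_n is the vertex i + 1 of
   1 -> 2 -> ... -> n. *)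
Definition linear_quiver (n : nat) : quiver :=
  @Quiver 'I_n (fun i j => is_true (val j == (val i).+1)).

(* The path of length m starting at the first vertex (unique for m < n). *)
Definition relation_1m (n m : nat) : relations (linear_quiver n) :=
  fun i j p => val (i : 'I_n) = 0%N /\ qlength p = m.

Arguments relation_1m : clear implicits.
Arguments number_of_exceptional_pairs F {Q} R k.

(* Main.v *)
From HB Require Import structures.
Require Import Defs.
From mathcomp Require Import all_boot all_order all_algebra.
From mathcomp Require Import zify ring.
(* Gives hom back its meaning as a morphism of modules, which the theory of
   vector spaces overrides. *)
Import Defs.

Set Implicit Arguments.
Unset Strict Implicit.
Unset Printing Implicit Defensive.

Import GRing.Theory.
Local Open Scope ring_scope.

(** Write I(a, b) for the interval module with support [a, b] (vertices are
    numbered from 0); it exists when a > 0 or b < m, since the relation kills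
    the path from 0 to m. Three facts reduce the theorem to a count of
    quadruples of integers.

    Every indecomposable is an interval module ([indecomposable_interval]). Take
    a longest path a -> b acting as a nonzero map, x at a with nonzero image y
    at b, and a complement C of the line of y. The images of x span a submodule
    U, and the vectors that transport to b inside C form a submodule W;
    maximality of the path makes them stable under the arrows, and they are
    complementary. As the module is indecomposable, U is everything.

    The module P(t) := I(t, n) (truncated at n - 1, and at m - 1 if t = 0) is
    projective, being free on its generator at t, and I(a, b) is resolved by
    P(a) <- P(b + 1) <- P(m) <- 0 if a = 0, and by P(a) <- P(b + 1) <- 0 if
    a > 0 ([interval_resolution]). As Hom(P(t), M) is M at t, the groups
    Ext^i(I(a, b), I(c, d)) are the cohomology of a complex of spaces of
    dimension at most 1 placed at the tops t of these projectives, with nonzero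
    maps wherever two consecutive ones are nonzero. So the exceptional pairs
    (I(c, d), I(a, b)) are those for which this complex is exact, a condition on
    which tops lie in [c, d] ([exceptional_interval]). Since the vanishing of
    Ext is asserted through some resolution, deducing it for this one needs the
    comparison theorem ([Ext_zeroE]).

    For fixed (a, b), the intervals (c, d) that satisfy the condition form a
    disjoint union of rectangles and triangles of integer points
    ([partner_indicator0], [partner_indicatorS]). Summing their sizes over (a, b)
    gives the polynomial ([total_rat]). *)

(** * Homomorphisms and submodules over a quiver *)

Section ModuleCategory.
Variables (F : fieldType) (Q : quiver) (R : relations Q).
Implicit Types M N X Y : module F R.

Fact id_hom_nat M (i j : Q) (a : arrow i j) :
  (\1 \o act M a)%VF = (act M a \o \1)%VF.
Proof. by rewrite comp_lfun1l comp_lfun1r. Qed.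

Definition id_hom M : hom M M := Hom (@id_hom_nat M).

Fact zero_hom_nat M N (i j : Q) (a : arrow i j) :
  (0 \o act M a)%VF = (act N a \o 0)%VF.
Proof. by rewrite comp_lfun0l comp_lfun0r. Qed.

Definition zero_hom M N : hom M N := Hom (fun i j a => @zero_hom_nat M N i j a).

Section Operations.
Variables (M N X : module F R) (f g : hom M N) (h : hom N X) (c : F).

Fact comp_hom_nat (i j : Q) (a : arrow i j) :
  ((h j \o f j) \o act M a)%VF = (act X a \o (h i \o f i))%VF.
Proof. by rewrite -comp_lfunA hom_nat !comp_lfunA hom_nat. Qed.

Definition comp_hom : hom M X := Hom comp_hom_nat.

Fact sub_hom_nat (i j : Q) (a : arrow i j) :
  ((f j - g j) \o act M a)%VF = (act N a \o (f i - g i))%VF.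
Proof. by rewrite comp_lfunDl comp_lfunDr comp_lfunNl comp_lfunNr !hom_nat. Qed.

Definition sub_hom : hom M N := Hom sub_hom_nat.

Fact scale_hom_nat (i j : Q) (a : arrow i j) :
  ((c *: f j) \o act M a)%VF = (act N a \o (c *: f i))%VF.
Proof. by rewrite -comp_lfunZl -comp_lfunZr hom_nat. Qed.

Definition scale_hom : hom M N := Hom scale_hom_nat.

End Operations.

Lemma hom_natE M N (f : hom M N) (i j : Q) (a : arrow i j) x :
  f j (act M a x) = act N a (f i x).
Proof. by rewrite -[LHS]comp_lfunE hom_nat comp_lfunE. Qed.

Lemma path_map_hom M N (f : hom M N) (i j : Q) (p : qpath i j) :
  (f j \o path_map (act M) p)%VF = (path_map (act N) p \o f i)%VF.
Proof.
elim: p => [i'|i' j' k' a p IH] /=; first by rewrite comp_lfun1l comp_lfun1r.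
by rewrite comp_lfunA IH -!comp_lfunA hom_nat.
Qed.

Lemma bijective_isomorphic M N (f : hom M N) :
  (forall v, lker (f v) = 0%VS) -> (forall v, limg (f v) = fullv) ->
  isomorphic M N.
Proof.
move=> kf lf.
have fK v : ((f v)^-1 \o f v)%VF = \1%VF 
  by apply: lker0_compVf; rewrite kf.
have Kf v : (f v \o (f v)^-1)%VF = \1%VF.
  by apply/lfunP => y; rewrite comp_lfunE id_lfunE limg_lfunVK // lf memvf.
have gnat (i j : Q) (a : arrow i j) :
    ((f j)^-1 \o act N a)%VF = (act M a \o (f i)^-1)%VF.
  rewrite -[RHS]comp_lfun1l -(fK j) -!comp_lfunA; congr (_ \o _)%VF.
  by rewrite comp_lfunA hom_nat -comp_lfunA Kf comp_lfun1r.
by exists f, (Hom gnat) => v; split=> /=.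
Qed.

Lemma isomorphic_sym M N : isomorphic M N -> isomorphic N M.
Proof. by move=> [f [g fg]]; exists g, f => v; case: (fg v). Qed.

(** Kernels of homomorphisms are needed as modules in their own right, to turn
    projectivity, a lifting property along surjections, into lifting along exact
    sequences. *)
Section Submodule.
Variables (M : module F R) (U : forall v : Q, {vspace M v}).
Hypothesis subU : submodule U.

Definition sub_space (v : Q) : vectType F := subvs_of (U v).

Definition sub_act (i j : Q) (a : arrow i j) : 'Hom(sub_space i, sub_space j) :=
  (linfun (vsproj (U j)) \o act M a \o linfun (@vsval _ _ (U i)))%VF.

Definition sub_incl (v : Q) : 'Hom(sub_space v, M v) := linfun (@vsval _ _ (U v)).

Lemma sub_actE (i j : Q) (a : arrow i j) (x : sub_space i) :
  vsval (sub_act a x) = act M a (vsval x).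
Proof.
rewrite !comp_lfunE !lfunE /= vsprojK //.
by have /subvP := subU a; apply; apply: memv_img; apply: subvsP.
Qed.

Lemma sub_incl_act (i j : Q) (a : arrow i j) :
  (sub_incl j \o sub_act a)%VF = (act M a \o sub_incl i)%VF.
Proof.
apply/lfunP => x; rewrite [LHS]comp_lfunE [RHS]comp_lfunE !(lfunE vsval).
exact: sub_actE.
Qed.

Lemma sub_incl_path (i j : Q) (p : qpath i j) :
  (sub_incl j \o path_map sub_act p)%VF = (path_map (act M) p \o sub_incl i)%VF.
Proof.
elim: p => [i'|i' j' k' a p IH] /=; first by rewrite comp_lfun1l comp_lfun1r.
by rewrite comp_lfunA IH -!comp_lfunA sub_incl_act.
Qed.

Lemma sub_act_rel (i j : Q) (p : qpath i j) : R p -> path_map sub_act p = 0.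
Proof.
move=> Rp; apply/lfunP => x; apply: val_inj.
have := congr1 (fun f : 'Hom(_, _) => f x) (sub_incl_path p).
by rewrite (act_rel M Rp) comp_lfun0l !zero_lfunE comp_lfunE lfunE.
Qed.

Definition sub_module : module F R := Module sub_act_rel.

Variables (X : module F R) (f : hom X M).
Hypothesis fU : forall v x, f v x \in U v.

Definition corestrict_fun (v : Q) : 'Hom(X v, sub_module v) :=
  (linfun (vsproj (U v)) \o f v)%VF.

Lemma corestrictK v x : vsval (corestrict_fun v x) = f v x.
Proof. by rewrite comp_lfunE lfunE /= vsprojK ?fU. Qed.

Fact corestrict_nat (i j : Q) (a : arrow i j) :
  (corestrict_fun j \o act X a)%VF = (act sub_module a \o corestrict_fun i)%VF.
Proof.
apply/lfunP => x; apply: val_inj; rewrite [in LHS]comp_lfunE [in RHS]comp_lfunE.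
transitivity (act M a (f i x)).
  by rewrite -hom_natE; apply: corestrictK.
exact: (esym (etrans (sub_actE a _) (congr1 (act M a) (corestrictK x)))).
Qed.

Definition corestrict : hom X sub_module := Hom corestrict_nat.

End Submodule.

Lemma lker_submodule M N (d : hom M N) : submodule (fun v => lker (d v)).
Proof.
move=> i j a; apply/subvP => _ /memv_imgP[x xk ->]; move: xk.
rewrite !memv_ker -!comp_lfunE hom_nat comp_lfunE => /eqP ->.
by rewrite linear0.
Qed.

(** Corestrict d' and f to the kernel of d: exactness makes the former
    surjective, so projectivity lifts the latter. *)
Lemma lift_exact P X Y N (d' : hom X Y) (d : hom Y N) (f : hom P Y) :
    projective P ->
    (forall v, limg (d' v) = lker (d v)) -> (forall v, (d v \o f v)%VF = 0) ->
  exists g : hom P X, forall v, (d' v \o g v)%VF = f v.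
Proof.
move=> projP ex df0.
have d'K v x : d' v x \in lker (d v) by rewrite -ex memv_img ?memvf.
have fK v x : f v x \in lker (d v).
  by rewrite memv_ker -comp_lfunE df0 zero_lfunE.
have /projP : surjective (corestrict (lker_submodule d) d'K).
  move=> v; apply/eqP; rewrite eqEsubv subvf; apply/subvP => y _.
  have : vsval y \in limg (d' v) by rewrite ex subvsP.
  case/memv_imgP => x _ yE; apply/memv_imgP; exists x; rewrite ?memvf //.
  by apply: val_inj; apply: etrans yE (esym (corestrictK (lker_submodule d) d'K x)).
move/(_ (corestrict (lker_submodule d) fK)) => [g gP]; exists g => v.
apply/lfunP => x; rewrite comp_lfunE.
rewrite -[LHS](corestrictK (lker_submodule d) d'K).
rewrite -[RHS](corestrictK (lker_submodule d) fK).
have := congr1 (fun h : 'Hom(_, _) => h x) (gP v).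
by rewrite [LHS]comp_lfunE => /(congr1 vsval).
Qed.

End ModuleCategory.

(** * Comparison of projective resolutions *)

Arguments term_projective [F Q R N] p k [X Y e].

Section Comparison.
Variables (F : fieldType) (Q : quiver) (R : relations Q).

Lemma diff_diff (N : module F R) (P : projective_resolution N) k v :
  (diff P k v \o diff P k.+1 v)%VF = 0.
Proof.
apply/lfunP => x; apply/eqP; rewrite zero_lfunE comp_lfunE -memv_ker -exact_diff.
by rewrite memv_img ?memvf.
Qed.

Lemma aug_diff (N : module F R) (P : projective_resolution N) v :
  (aug P v \o diff P 0 v)%VF = 0.
Proof.
apply/lfunP => x; apply/eqP; rewrite zero_lfunE comp_lfunE -memv_ker -exact_aug.
by rewrite memv_img ?memvf.
Qed.

Variables (N M : module F R).

Lemma extend_chain_map (P P' : projective_resolution N) k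
    (f : hom (P k) (P' k)) (f' : hom (P k.+1) (P' k.+1)) :
    (forall v, diff P' k v \o f' v = f v \o diff P k v)%VF ->
  exists f'' : hom (P k.+2) (P' k.+2),
    forall v, (diff P' k.+1 v \o f'' v = f' v \o diff P k.+1 v)%VF.
Proof.
move=> comm.
have [v /=|f'' f''P] := lift_exact (f := comp_hom (diff P k.+1) f')
  (term_projective P k.+2) (exact_diff P' k); last by exists f''.
by rewrite comp_lfunA comm -comp_lfunA diff_diff comp_lfun0r.
Qed.

Lemma start_chain_map (P P' : projective_resolution N) :
  exists (f : hom (P 0%N) (P' 0%N)) (f' : hom (P 1%N) (P' 1%N)),
    (forall v, aug P' v \o f v = aug P v)%VF /\
    (forall v, diff P' 0 v \o f' v = f v \o diff P 0 v)%VF.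
Proof.
have [f fP] := term_projective P 0 (aug P) (aug_surjective P').
exists f.
have [|f' f'P] := lift_exact (f := comp_hom (diff P 0) f)
  (term_projective P 1) (exact_aug P').
  by move=> v /=; rewrite comp_lfunA fP aug_diff.
by exists f'.
Qed.

(** One step of the homotopy between the identity and g f: the hypothesis on s
    says that \1 - g' f' - s d is killed by d, so it lifts through the next d. *)
Lemma extend_homotopy (P P' : projective_resolution N) k
    (f : hom (P k) (P' k)) (f' : hom (P k.+1) (P' k.+1))
    (g : hom (P' k) (P k)) (g' : hom (P' k.+1) (P k.+1)) (s : hom (P k) (P k.+1)) :
    (forall v, diff P' k v \o f' v = f v \o diff P k v)%VF ->
    (forall v, diff P k v \o g' v = g v \o diff P' k v)%VF ->
    (forall v, diff P k v \o (s v \o diff P k v) =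
               diff P k v - ((g v \o f v) \o diff P k v))%VF ->
  exists s' : hom (P k.+1) (P k.+2), forall v,
    (diff P k.+1 v \o s' v = \1 - (g' v \o f' v) - (s v \o diff P k v))%VF.
Proof.
move=> Hf Hg Hs.
have [v /=|s' Hs'] := lift_exact
  (f := sub_hom (sub_hom (id_hom _) (comp_hom f' g')) (comp_hom (diff P k) s))
  (term_projective P k.+1) (exact_diff P k); last by exists s'.
rewrite !comp_lfunDr !comp_lfunNr comp_lfun1r Hs.
by rewrite comp_lfunA Hg -!comp_lfunA Hf subrr.
Qed.

(** The usual chain maps and homotopy, seen at two consecutive degrees. Keeping
    only what the next step uses (the squares, and the homotopy relation composed
    with d) lets a plain induction replace the choice of infinite families; it
    also makes degree 0, where the augmentation intervenes, an ordinary case. *)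
Lemma comparison (P P' : projective_resolution N) k :
  exists (f : hom (P k) (P' k)) (f' : hom (P k.+1) (P' k.+1))
         (g : hom (P' k) (P k)) (g' : hom (P' k.+1) (P k.+1))
         (s : hom (P k) (P k.+1)),
    [/\ forall v, (diff P' k v \o f' v = f v \o diff P k v)%VF,
        forall v, (diff P k v \o g' v = g v \o diff P' k v)%VF
      & forall v, (diff P k v \o (s v \o diff P k v) =
                   diff P k v - ((g v \o f v) \o diff P k v))%VF].
Proof.
elim: k => [|k [f [f' [g [g' [s [Hf Hg Hs]]]]]]].
  have [f [f' [af Hf]]] := start_chain_map P P'.
  have [g [g' [ag Hg]]] := start_chain_map P' P.
  have [|s Hs] := lift_exact (f := sub_hom (id_hom _) (comp_hom f g))
    (term_projective P 0) (exact_aug P).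
    by move=> v /=; rewrite comp_lfunDr comp_lfunNr comp_lfun1r comp_lfunA ag af subrr.
  exists f, f', g, g', s; split=> // v.
  by rewrite comp_lfunA Hs /= comp_lfunDl comp_lfunNl comp_lfun1l.
have [f'' Hf'] := extend_chain_map Hf.
have [g'' Hg'] := extend_chain_map Hg.
have [s' Hs'] := extend_homotopy Hf Hg Hs.
exists f', f'', g', g'', s'; split=> // v.
rewrite comp_lfunA Hs' /= !comp_lfunDl !comp_lfunNl comp_lfun1l.
by rewrite -[X in _ - X]comp_lfunA diff_diff comp_lfun0r subr0.
Qed.

(** A cocycle u on P pulls back along g' to a cocycle on P', hence to a coboundary
    w d there; pulling w d back along f' and adding the homotopy term u s d
    recovers u. *)
Lemma Ext_zeroE (P : projective_resolution N) k :
  Ext_zero k.+1 N M <->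
  forall f : hom (P k.+1) M, cocycle f -> coboundary f.
Proof.
split=> [[P' vanP'] u cocu|]; last by exists P.
have [f [f' [g [g' [s [Hf Hg Hs]]]]]] := comparison P P' k.
have [g'' Hg'] := extend_chain_map Hg.
have [|w Hw] := vanP' (comp_hom g' u).
  by move=> v /=; rewrite -comp_lfunA -Hg' comp_lfunA cocu comp_lfun0l.
have [s' Hs'] := extend_homotopy Hf Hg Hs.
(* With composition in traditional order: \1 = g' f' + s d + d s', u d = 0 and
   u g' = w d give u = w d f' + u s d = (w f + u s) d. The summand w f is
   subtracted from u s as - (w f). *)
exists (sub_hom (comp_hom s u) (scale_hom (comp_hom f w) (- 1))) => v /=.
have /(congr1 (fun z => (u v \o z)%VF)) := Hs' v.
rewrite comp_lfunA cocu comp_lfun0l /= !comp_lfunDr !comp_lfunNr comp_lfun1r.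
move/esym/eqP; rewrite subr_eq0 subr_eq => /eqP uE; rewrite [LHS]uE.
rewrite scaleN1r opprK comp_lfunDl -!comp_lfunA; congr (_ + _).
by rewrite -Hf !comp_lfunA -Hw.
Qed.

End Comparison.

(** * Invariance under isomorphism *)

Section IsomorphismInvariance.
Variables (F : fieldType) (Q : quiver) (R : relations Q).
Implicit Types M N : module F R.

Lemma exceptional_pair_iso M M' N N' :
  isomorphic M M' -> isomorphic N N' ->
  exceptional_pair M N -> exceptional_pair M' N'.
Proof.
move=> [f [f' ff']] [g [g' gg']] [hom0 ext0]; split.
  move=> u v; have u0 := hom0 (comp_hom g (comp_hom u f')) v.
  have [_ fK] := ff' v; have [_ gK] := gg' v.
  rewrite -[LHS]comp_lfun1l -fK -[u v]comp_lfun1r -gK.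
  rewrite -comp_lfunA (comp_lfunA (f' v)) (comp_lfunA (f' v \o u v)%VF).
  by move: u0 => /= ->; rewrite comp_lfun0l comp_lfun0r.
case=> [//|i] _; have [P vanP] := ext0 i.+1 isT.
have surj : surjective (comp_hom (aug P) g).
  move=> v /=; rewrite limg_comp aug_surjective.
  have [_ gK] := gg' v; apply/eqP; rewrite eqEsubv subvf; apply/subvP => y _.
  by apply/memv_imgP; exists (g' v y); rewrite ?memvf // -comp_lfunE gK id_lfunE.
have ex v : limg (diff P 0 v) = lker (comp_hom (aug P) g v).
  rewrite exact_aug; apply/eqP; rewrite eqEsubv; have [gK _] := gg' v.
  apply/andP; split; apply/subvP => x; rewrite !memv_ker comp_lfunE => /eqP.
    by move=> ->; rewrite linear0.
  move/(congr1 (g' v)); rewrite linear0 => /eqP.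
  by rewrite -comp_lfunE gK id_lfunE.
exists (ProjectiveResolution (@term_projective _ _ _ _ P) surj ex
          (exact_diff P)) => u cocu.
have [v /=|w wP] := vanP (comp_hom u f').
  by rewrite -comp_lfunA [X in (_ \o X)%VF]cocu comp_lfun0r.
exists (comp_hom w f) => v /=; have [_ fK] := ff' v.
by rewrite -comp_lfunA -wP /= comp_lfunA fK comp_lfun1l.
Qed.

End IsomorphismInvariance.

(** * Paths of the linear quiver and the maps they induce *)

Section LinearQuiver.
Variable n : nat.
Notation Q := (linear_quiver n).

Lemma arrow_val (i j : Q) (a : arrow i j) : val (j : 'I_n) = (val (i : 'I_n)).+1.
Proof. exact/eqP/a. Qed.

Lemma qpath_val (i j : Q) (p : qpath i j) :
  val (j : 'I_n) = (val (i : 'I_n) + qlength p)%N.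
Proof.
elim: p => [i'|i' j' k' a p IH] /=; first by rewrite addn0.
by rewrite IH (arrow_val a) addSnnS.
Qed.

Lemma linear_path (i j : 'I_n) : (i <= j)%N -> @qpath Q i j.
Proof.
move: {2}(j - i)%N (erefl (j - i)%N) => d; elim: d i => [|d IH] i ij ilej.
  have -> : i = j by apply: val_inj => /=; lia.
  exact: qpath_nil.
have lt_n : (i.+1 < n)%N by have := ltn_ord j; lia.
apply: (@qpath_cons Q i (Ordinal lt_n) j (eqxx _)).
by apply: IH => /=; lia.
Qed.

Lemma qpath_inv (i k : Q) (q : qpath i k) :
  (exists e : i = k, q = ecast z (qpath i z) e (qpath_nil i)) \/
  (exists (j : Q) (a : arrow i j) (q' : qpath j k), q = qpath_cons a q').
Proof.
by case: q => [i'|i' j k' a q]; [left; exists erefl | right; exists j, a, q].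
Qed.

(** Endpoints determine a path, so that the maps of a representation along paths
    are indexed by pairs of vertices (see [transport] below). *)
Lemma qpath_unique (i j : Q) (p q : qpath i j) : p = q.
Proof.
elim: p q => [i'|i' j' k' a p IH] q; have /= lq := qpath_val q;
  have [[e ->]|[j'' [a' [q' def_q]]]] := qpath_inv q.
- by rewrite (@eq_irrelevance 'I_n _ _ e erefl).
- by move: lq; rewrite def_q /=; lia.
- have /= lp := qpath_val p; have /= la := arrow_val a.
  by have := congr1 val e; rewrite /= lp la; lia.
- have ej : j'' = j' by apply: (@val_inj _ _ 'I_n); rewrite (arrow_val a) (arrow_val a').
  rewrite def_q; case: _ / (esym ej) a' q' {def_q} => a' q'.
  by rewrite (IH q') (bool_irrelevance a' a).
Qed.

End LinearQuiver.

Section Transport.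
Variables (F : fieldType) (n m : nat).
Notation Q := (linear_quiver n).
Notation modl := (module F (relation_1m n m)).
Implicit Types M N : modl.

(** The map M_i -> M_j along the path from i to j, or 0 if there is none; being
    total in i and j, it spares proofs of i <= j inside terms. *)
Definition transport M (i j : 'I_n) : 'Hom(M i, M j) :=
  match boolP (i <= j)%N with
  | AltTrue le_ij => path_map (act M) (linear_path le_ij)
  | AltFalse _ => 0
  end.

Lemma path_transport M (i j : Q) (p : qpath i j) :
  path_map (act M) p = transport M i j.
Proof.
rewrite /transport; case: {-}_ / boolP => [le_ij|].
  by rewrite (qpath_unique p (linear_path le_ij)).
by have /= := qpath_val p; lia.
Qed.

Lemma transport_gt M (i j : 'I_n) : (j < i)%N -> transport M i j = 0.
Proof. by rewrite /transport; case: {-}_ / boolP => //; lia. Qed.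

Lemma transport_refl M (i : 'I_n) : transport M i i = \1%VF.
Proof. by rewrite -(path_transport M (qpath_nil (i : Q))). Qed.

Lemma transport_arrow M (i j : Q) (a : arrow i j) : transport M i j = act M a.
Proof. by rewrite -(path_transport M (qpath_cons a (qpath_nil j))) /= comp_lfun1l. Qed.

Lemma transport_comp M (i j k : 'I_n) : (i <= j <= k)%N ->
  (transport M j k \o transport M i j)%VF = transport M i k.
Proof.
case/andP => le_ij le_jk.
rewrite -(path_transport M (linear_path le_ij)).
elim: (linear_path le_ij) le_jk => [i'|i' j' k' a p IH] le_jk.
  by rewrite comp_lfun1r.
have le_j'k : (j' <= k)%N by have := qpath_val p; move: le_jk => /=; lia.
rewrite /= comp_lfunA IH // -(path_transport M (linear_path le_j'k)).
by rewrite -(path_transport M (qpath_cons a (linear_path le_j'k))).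
Qed.

Lemma transport_compE M (i j k : 'I_n) x : (i <= j <= k)%N ->
  transport M j k (transport M i j x) = transport M i k x.
Proof. by move=> le_ijk; rewrite -comp_lfunE transport_comp. Qed.

Lemma hom_transport M N (f : hom M N) (i j : 'I_n) x :
  f j (transport M i j x) = transport N i j (f i x).
Proof.
rewrite -!comp_lfunE; congr (fun_of_lfun _ x).
have [le_ij|lt_ji] := leqP i j; last by rewrite !transport_gt // comp_lfun0l comp_lfun0r.
by rewrite -!(path_transport _ (linear_path le_ij)) path_map_hom.
Qed.

Lemma transport_relation M (i j : 'I_n) :
  val i = 0%N -> (m <= j)%N -> (m < n)%N -> transport M i j = 0.
Proof.
move=> i0 le_mj lt_mn; set k := Ordinal lt_mn.
have le_ik : (i <= k)%N by rewrite /= i0.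
rewrite -(@transport_comp M i k j) ?le_ik //.
rewrite -(path_transport M (linear_path le_ik)) act_rel ?comp_lfun0r //.
by split=> //; have /= := qpath_val (linear_path le_ik); rewrite i0.
Qed.

End Transport.

(** * Interval modules and their homomorphisms *)

Section OnesMap.
Variable F : fieldType.

(** Only used for p and q booleans seen as dimensions 0 or 1, where it is the
    identity of F if p = q = 1 and 0 otherwise. *)
Definition ones_map (p q : nat) : 'Hom('rV[F]_p, 'rV[F]_q) :=
  linfun (mulmxr (const_mx 1)).

(** On a row vector of length at most 1, this reads off its coordinate without
    having to exhibit an index. *)
Definition entry_sum p (x : 'rV[F]_p) : F := \sum_j x 0 j.

Lemma rV_false (p : bool) (x : 'rV[F]_p) : ~~ p -> x = 0.
Proof. by case: p x => // x _; rewrite thinmx0. Qed.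

Lemma ones_mapE (p q : nat) x : ones_map p q x = entry_sum x *: const_mx 1.
Proof.
rewrite lfunE /=; apply/rowP => j; rewrite !mxE mulr1.
by apply: eq_bigr => i _; rewrite !mxE mulr1.
Qed.

Lemma entry_sum0 p : entry_sum (0 : 'rV[F]_p) = 0.
Proof. by rewrite /entry_sum big1 // => j _; rewrite mxE. Qed.

Lemma entry_sumZ p (c : F) (x : 'rV[F]_p) : entry_sum (c *: x) = c * entry_sum x.
Proof. by rewrite /entry_sum mulr_sumr; apply: eq_bigr => j _; rewrite mxE. Qed.

Lemma entry_sum1 (p : bool) : entry_sum (const_mx 1 : 'rV[F]_p) = p%:R.
Proof.
case: p; rewrite /entry_sum; last by rewrite big_ord0.
by rewrite big_ord1 mxE.
Qed.

Lemma entry_sumK (p : bool) (x : 'rV[F]_p) : entry_sum x *: const_mx 1 = x.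
Proof.
case: p x => x; last by rewrite !thinmx0.
by apply/rowP => j; rewrite !mxE mulr1 /entry_sum big_ord1 (ord1 j).
Qed.

Lemma entry_sum_false (p : bool) (x : 'rV[F]_p) : ~~ p -> entry_sum x = 0.
Proof. by move=> np; rewrite (rV_false x np) entry_sum0. Qed.

Lemma ones_map_id (p : bool) : ones_map p p = \1%VF.
Proof. by apply/lfunP => x; rewrite ones_mapE entry_sumK id_lfunE. Qed.

Lemma ones_map_comp (p q r : bool) : p && r ==> q ->
  (ones_map q r \o ones_map p q)%VF = ones_map p r.
Proof.
move=> /implyP pqr; apply/lfunP => x; rewrite comp_lfunE !ones_mapE entry_sumZ entry_sum1.
case: p x pqr => x pqr; last by rewrite (rV_false x) // /entry_sum big_ord0 mul0r.
by case: r q pqr => [|] [|] // pqr; rewrite ?mulr1 ?thinmx0 ?scaler0 //; have := pqr isT.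
Qed.

Lemma ones_map_exact (p q r : bool) : (q ==> p (+) r) ->
  limg (ones_map p q) = lker (ones_map q r).
Proof.
case: q => [|_]; last first.
  by apply/vspaceP => x; rewrite (rV_false x) // !mem0v.
case: p r => [] [] // _.
  rewrite ones_map_id lim1g; apply/vspaceP => x.
  by rewrite memvf memv_ker; apply/esym/eqP; rewrite [LHS]thinmx0.
apply/vspaceP => x; rewrite memv_ker ones_map_id id_lfunE.
apply/memv_imgP/eqP => [[y _ ->]|->]; first by rewrite (rV_false y) ?linear0.
by exists 0; rewrite ?memvf ?linear0.
Qed.

Variable V : vectType F.

Definition spread p (y : V) (x : 'rV[F]_p) : V := entry_sum x *: y.

Fact spread_linear p (y : V) : linear (@spread p y).
Proof.
move=> c u v; rewrite /spread /entry_sum scalerA -scalerDl; congr (_ *: _).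
by rewrite mulr_sumr -big_split; apply: eq_bigr => j _; rewrite !mxE.
Qed.

HB.instance Definition _ p (y : V) :=
  GRing.isLinear.Build F 'rV[F]_p V *:%R (@spread p y) (spread_linear y).

End OnesMap.

Section Intervals.
Variables (F : fieldType) (n m : nat).
Notation Q := (linear_quiver n).
Notation modl := (module F (relation_1m n m)).

(** The support of I(a, b) at all natural numbers a and b: an interval that starts
    at 0 is cut off at m - 1 to satisfy the relation. So [in_interval t n] is
    the support of the projective at t, and an empty one yields the zero module. *)
Definition in_interval (a b v : nat) : bool :=
  ((a <= v <= b) && ((0 < a) || (v < m)))%N.

Definition interval_space (a b : nat) (v : Q) : vectType F :=
  'rV[F]_(in_interval a b (v : 'I_n)).

Definition interval_act (a b : nat) (v w : Q) (_ : arrow v w) :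
    'Hom(interval_space a b v, interval_space a b w) :=
  ones_map F (in_interval a b (v : 'I_n)) (in_interval a b (w : 'I_n)).

Lemma interval_path (a b : nat) (v w : Q) (p : qpath v w) :
  path_map (@interval_act a b) p =
  ones_map F (in_interval a b (v : 'I_n)) (in_interval a b (w : 'I_n)).
Proof.
elim: p => [i|i j k e p IH] /=; first by rewrite ones_map_id.
rewrite IH ones_map_comp //.
have /= := qpath_val p; have /= := arrow_val e.
by rewrite /in_interval => -> ->; lia.
Qed.

Fact interval_rel (a b : nat) (v w : Q) (p : qpath v w) :
  relation_1m n m v w p -> path_map (@interval_act a b) p = 0.
Proof.
move=> [v0 lp]; rewrite interval_path; apply/lfunP => x; rewrite zero_lfunE.
have /= wE := qpath_val p; rewrite /= in v0.
have: ~~ (in_interval a b v && in_interval a b w) by rewrite /in_interval wE v0 lp; lia.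
by rewrite negb_and => /orP[/(rV_false x) ->|/rV_false]; [rewrite linear0 | apply].
Qed.

Definition interval_module (a b : nat) : modl := Module (@interval_rel a b).

Lemma interval_transport (a b : nat) (v w : 'I_n) : (v <= w)%N ->
  transport (interval_module a b) v w =
  ones_map F (in_interval a b v) (in_interval a b w).
Proof.
by move=> le_vw; rewrite -(path_transport _ (linear_path le_vw)) interval_path.
Qed.

Definition canonical_fun (a b c d : nat) (v : Q) :
    'Hom(interval_module a b v, interval_module c d v) :=
  ones_map F (in_interval a b (v : 'I_n)) (in_interval c d (v : 'I_n)).

(** At an arrow v -> v + 1, both composites of the naturality square vanish unless
    v lies in the first support and v + 1 in the second; the compatibility
    condition makes the two intermediate spaces nonzero in that case, so that both
    composites are the identity of F. *)
Fact canonical_nat (a b c d : nat) :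
  (forall v, (v.+1 < n)%N -> in_interval a b v -> in_interval c d v.+1 ->
     in_interval a b v.+1 && in_interval c d v) ->
  forall (v w : Q) (e : arrow v w),
    (canonical_fun a b c d w \o act (interval_module a b) e)%VF =
    (act (interval_module c d) e \o canonical_fun a b c d v)%VF.
Proof.
move=> compat v w e.
have := compat (v : 'I_n); have := arrow_val e; rewrite /= => <- /(_ (ltn_ord w)) cp.
rewrite [LHS]ones_map_comp ?[RHS]ones_map_comp //;
by apply/implyP => /andP[h h']; case/andP: (cp h h').
Qed.

Definition canonical (a b c d : nat) compat : hom (interval_module a b) (interval_module c d) :=
  Hom (@canonical_nat a b c d compat).

(** I(a, b) is generated at a, subject only to the relations that kill the
    generator outside the support. *)
Lemma interval_hom (M : modl) (a : 'I_n) (b : nat) (u : M a) :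
  (forall v : 'I_n, (a <= v)%N -> ~~ in_interval a b v -> transport M a v u = 0) ->
  exists f : hom (interval_module a b) M,
    forall (v : 'I_n) x, f v x = entry_sum x *: transport M a v u.
Proof.
move=> u0.
pose f (v : Q) : 'Hom(interval_module a b v, M v) :=
  linfun (@spread F (M v) (in_interval a b (v : 'I_n)) (transport M a v u)).
have fE v x : f v x = entry_sum x *: transport M a v u by rewrite lfunE.
have nat_f (v w : Q) (e : arrow v w) :
    (f w \o act (interval_module a b) e)%VF = (act M e \o f v)%VF.
  apply/lfunP => x; rewrite [LHS]comp_lfunE [RHS]comp_lfunE !fE linearZ /=.
  rewrite [X in entry_sum X]ones_mapE entry_sumZ entry_sum1.
  have [vI|/(entry_sum_false x) ->] := orP (orbN (in_interval a b (v : 'I_n))); last first.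
    by rewrite mul0r !scale0r.
  have le_av : (a <= (v : 'I_n))%N by case/andP: vI => /andP[].
  have le_vw : ((v : 'I_n) <= (w : 'I_n))%N by rewrite (arrow_val e).
  rewrite -transport_arrow transport_compE ?le_av //.
  have [wI|wI] := orP (orbN (in_interval a b (w : 'I_n))); first by rewrite wI mulr1.
  by rewrite u0 ?scaler0 // (leq_trans le_av).
by exists (Hom nat_f).
Qed.

Lemma interval_homE (M : modl) (a : 'I_n) (b : nat) (f : hom (interval_module a b) M)
    (v : 'I_n) (x : interval_module a b v) :
  in_interval a b a -> f v x = entry_sum x *: transport M a v (f a (const_mx 1)).
Proof.
move=> aI.
have [vI|vI] := orP (orbN (in_interval a b v)); last first.
  by rewrite (entry_sum_false x vI) [x](rV_false x vI) linear0 scale0r.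
have le_av : (a <= v)%N by case/andP: vI => /andP[].
rewrite -hom_transport interval_transport // -linearZ /= ones_mapE entry_sum1 aI scale1r.
by congr (f v _); apply/esym/entry_sumK.
Qed.

Lemma interval_isomorphic (a b c d : nat) (v : 'I_n) :
  isomorphic (interval_module a b) (interval_module c d) -> in_interval a b v = in_interval c d v.
Proof.
suff sub (a' b' c' d' : nat) : isomorphic (interval_module a' b') (interval_module c' d') ->
    in_interval a' b' v -> in_interval c' d' v.
  by move=> iso; apply/idP/idP; apply: sub => //; apply: isomorphic_sym.
move=> [f [g /(_ v)[gf _]]] vI; apply: contraT => vI'.
pose e : interval_module a' b' v := const_mx 1 : 'rV[F]_(in_interval a' b' v).
have : entry_sum e = 1 by rewrite entry_sum1 vI.
have <- : g v (f v e) = e by rewrite -comp_lfunE gf id_lfunE.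
rewrite [f v e](rV_false _ vI') linear0 entry_sum0 => /esym/eqP.
by rewrite oner_eq0.
Qed.

End Intervals.

(** * Resolutions and exceptional pairs of interval modules *)

Section Exceptional.
Variables (F : fieldType) (n m : nat).
Hypotheses (m_gt0 : (0 < m)%N) (lt_mn : (m < n)%N).
Notation Q := (linear_quiver n).
Notation modl := (module F (relation_1m n m)).
Notation I a b := (interval_module F n m a b).
Notation inI := (in_interval m).
Implicit Types a b c d t : nat.

(** The generator has nowhere to go. Stated without a < n: for larger a the source
    is the zero module. *)
Lemma hom_outside a b c d (f : hom (I a b) (I c d)) (v : 'I_n) :
  ~~ inI c d a -> f v = 0.
Proof.
move=> aI; apply/lfunP => x; rewrite zero_lfunE.
have [vI|vI] := orP (orbN (inI a b v)); last by rewrite [x](rV_false _ vI) linear0.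
have lt_an : (a < n)%N by move: vI; rewrite /in_interval; have := ltn_ord v; lia.
have aI' : inI a b (Ordinal lt_an) by move: vI; rewrite /in_interval /=; lia.
rewrite (interval_homE (a := Ordinal lt_an) f x aI').
by rewrite [f _ _](rV_false _ aI) linear0 scaler0.
Qed.

Lemma hom_inside a b c d (f : hom (I a b) (I c d)) :
  (a < n)%N -> inI a b a ->
  exists l : F, forall v : Q, f v = l *: canonical_fun F m a b c d v.
Proof.
move=> lt_an aI; pose a' := Ordinal lt_an.
exists (entry_sum (f a' (const_mx 1) : 'rV[F]_(inI c d a))) => v; apply/lfunP => x.
rewrite (interval_homE (a := a') f x aI) scale_lfunE [X in _ = _ *: X]ones_mapE.
have [vI|vI] := orP (orbN (inI a b (v : 'I_n))); last first.
  by rewrite (entry_sum_false x vI) !scale0r scaler0.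
have le_av : (a' <= (v : 'I_n))%N by move: vI; rewrite /in_interval /=; lia.
by rewrite interval_transport // [X in _ *: X = _]ones_mapE !scalerA mulrC.
Qed.

Lemma ones_map_neq0 (p q : bool) : p -> q -> ones_map F p q <> 0.
Proof.
move=> hp hq /lfunP/(_ (const_mx 1)); rewrite zero_lfunE ones_mapE entry_sum1 hp scale1r.
move/(congr1 (@entry_sum F q)); rewrite entry_sum1 hq entry_sum0 => /eqP.
by rewrite oner_eq0.
Qed.

(** The support of I(t, n) misses a vertex v >= t only when the relation kills the
    path from t to v, so I(t, n) is free on one generator and a homomorphism is
    lifted by lifting the image of that generator. *)
Lemma interval_projective t : projective (I t n).
Proof.
move=> X Y e f surj.
have [le_nt|lt_tn] := leqP n t.
  exists (zero_hom _ _) => v; apply/lfunP => x.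
  rewrite [x](rV_false _ (p := inI t n (v : 'I_n))) ?linear0 //.
  by rewrite /in_interval; have := ltn_ord (v : 'I_n); lia.
pose t' := Ordinal lt_tn; have tI : inI t n t' by rewrite /in_interval /=; lia.
have /memv_imgP[x _ xE] : f t' (const_mx 1) \in limg (e t') by rewrite surj memvf.
have [v le_tv vI|g gE] := @interval_hom F n m X t' n x.
  move: vI; have := ltn_ord v; rewrite /in_interval => lt_vn vI.
  by rewrite transport_relation ?zero_lfunE //=; move: le_tv vI => /=; lia.
exists g => v; apply/lfunP => y.
rewrite comp_lfunE gE linearZ /= hom_transport -xE.
by rewrite [RHS](interval_homE (a := t') f y tI).
Qed.

(** The tops of the projectives in the resolution of I(a, b). The kernel of
    P(a) -> I(a, b) is I(b + 1, n) for a > 0, which is projective, but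
    I(b + 1, m - 1) for a = 0, whose own cover P(b + 1) has kernel P(m). For
    b = m - 1 this leaves the identity of P(m) in degrees 2 and 1, still exact.
    The top n stands for the zero module. *)
Definition syzygy_top a b (k : nat) : nat :=
  match k with 0%N => a | 1%N => b.+1 | 2%N => if a == 0%N then m else n | _ => n end.

Section Resolution.
Variables a b : nat.
Hypotheses (ab_interval : (a <= b < n)%N) (ab_top : inI a b b).
Notation t := (syzygy_top a b).

Fact diff_compat k v : (v.+1 < n)%N -> inI (t k.+1) n v -> inI (t k) n v.+1 ->
  inI (t k.+1) n v.+1 && inI (t k) n v.
Proof.
by case: k => [|[|[|k]]] /=; move: ab_interval ab_top; rewrite /in_interval;
  try case: eqP; lia.
Qed.

Fact aug_compat v : (v.+1 < n)%N -> inI a n v -> inI a b v.+1 ->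
  inI a n v.+1 && inI a b v.
Proof. by move: ab_interval ab_top; rewrite /in_interval; lia. Qed.

Fact aug_surj : surjective (canonical F aug_compat).
Proof.
move=> v; apply/vspaceP => x; rewrite memvf; apply/memv_imgP.
have [vI|vI] := orP (orbN (inI a b (v : 'I_n))); last first.
  by exists 0; rewrite ?memvf // linear0; apply: rV_false.
have vI' : inI a n (v : 'I_n).
  by move: vI; rewrite /in_interval; have := ltn_ord (v : 'I_n); lia.
exists (entry_sum x *: const_mx 1 : 'rV[F]_(inI a n (v : 'I_n))); rewrite ?memvf //.
by rewrite [RHS]ones_mapE entry_sumZ entry_sum1 vI' mulr1; apply/esym/entry_sumK.
Qed.

Fact aug_exact (v : Q) :
  limg (canonical F (@diff_compat 0) v) = lker (canonical F aug_compat v).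
Proof.
apply: ones_map_exact; have := ltn_ord (v : 'I_n).
by move: ab_interval ab_top; rewrite /in_interval /=; lia.
Qed.

Fact diff_exact k (v : Q) :
  limg (canonical F (@diff_compat k.+1) v) = lker (canonical F (@diff_compat k) v).
Proof.
apply: ones_map_exact; have := ltn_ord (v : 'I_n).
by case: k => [|[|[|k]]]; move: ab_interval ab_top; rewrite /in_interval /=;
  try case: eqP; lia.
Qed.

Definition interval_resolution : projective_resolution (I a b) :=
  ProjectiveResolution (term := fun k => I (t k) n) (fun k => @interval_projective (t k))
    aug_surj aug_exact diff_exact.

End Resolution.
(** With h k the dimension of Hom(P_k, I(c, d)), which is at most 1, this is
    exactness of the complex h 0 -> h 1 -> h 2 -> 0. The disjunction is exclusive
    in effect: if h 0 and h 2 both hold, then a = 0, and [c, d] would contain both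
    0 and m. *)
Definition exceptional_cond a b c d : bool :=
  let h k := inI c d (syzygy_top a b k) in
  [&& h 0%N ==> h 1%N, h 1%N ==> h 0%N || h 2%N & h 2%N ==> h 1%N].

Section Criterion.
Variables a b c d : nat.
Hypotheses (ab_interval : (a <= b < n)%N) (ab_top : inI a b b).
Hypotheses (cd_interval : (c <= d < n)%N) (cd_top : inI c d d).
Notation h k := (inI c d (syzygy_top a b k)).
Notation P := (interval_resolution ab_interval ab_top).

Lemma Hom_zero_interval : Hom_zero (I a b) (I c d) <-> (h 0%N ==> h 1%N).
Proof.
have lt_an : (a < n)%N by lia.
have aI : inI a b a by move: ab_interval ab_top; rewrite /in_interval /=; lia.
split=> [hom0|/implyP h01 f v].
  apply/implyP => h0; apply: contraT => h1.
  have compat v : (v.+1 < n)%N -> inI a b v -> inI c d v.+1 ->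
      inI a b v.+1 && inI c d v.
    move: h0 h1 ab_interval ab_top cd_interval cd_top; rewrite /in_interval /=; lia.
  have := hom0 (canonical F compat) (Ordinal lt_an).
  by case/(ones_map_neq0 aI h0).
have [h0|h0] := orP (orbN (h 0%N)); last exact: hom_outside.
have h1 := h01 h0; have lt_bn : (b.+1 < n)%N.
  by move: h1 cd_interval; rewrite /in_interval /=; lia.
pose a' := Ordinal lt_an; pose b' := Ordinal lt_bn.
pose e : I a b a' := const_mx 1 : 'rV[F]_(inI a b a).
(* The image of the generator dies at b + 1, where transport is injective. *)
have fe0 : f a' e = 0.
  have b'I : ~~ inI a b b' by rewrite /in_interval /=; lia.
  have := hom_transport f b' e; rewrite [transport _ _ _ e](rV_false _ b'I) linear0.
  rewrite interval_transport ?[RHS]ones_mapE; last by move: ab_interval => /=; lia.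
  move/esym/(congr1 (@entry_sum F (inI c d b'))).
  rewrite entry_sumZ entry_sum1 [RHS]entry_sum0 [inI c d b']h1 mulr1 => es0.
  by rewrite -[LHS](@entry_sumK F (inI c d a)) es0 scale0r.
apply/lfunP => x; rewrite (interval_homE (a := a') f x aI) fe0.
by rewrite linear0 scaler0 zero_lfunE.
Qed.

(** A homomorphism from P(t) is determined by its value at the top t. *)
Lemma hom_inside_neq0 t (lt_tn : (t < n)%N) (l : F) :
  inI t n t -> inI c d t -> l *: canonical_fun F m t n c d (Ordinal lt_tn) = 0 -> l = 0.
Proof.
move=> tI tI' /eqP; rewrite scaler_eq0 => /orP[/eqP //|/eqP].
by case/(ones_map_neq0 tI tI').
Qed.

(** A class in Ext^(k+1) is represented by a multiple of the canonical map
    P_(k+1) -> I(c, d). That map fails to be a cocycle exactly when h (k+2) holds,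
    and is a coboundary exactly when h k holds. *)
Lemma Ext_zero_interval k :
  Ext_zero k.+1 (I a b) (I c d) <-> (h k.+1 ==> h k || h k.+2).
Proof.
have top_lt j : h j -> (syzygy_top a b j < n)%N.
  by move: cd_interval; rewrite /in_interval; lia.
have top_in j : h j -> inI (syzygy_top a b j) n (syzygy_top a b j).
  by move: cd_interval; rewrite /in_interval; lia.
rewrite (Ext_zeroE _ P); split=> [van|/implyP cond f cocf].
  apply/implyP => h1; apply: contraT; rewrite negb_or => /andP[h0 h2].
  have compat v : (v.+1 < n)%N -> inI (syzygy_top a b k.+1) n v -> inI c d v.+1 ->
      inI (syzygy_top a b k.+1) n v.+1 && inI c d v.
    by move: h1 cd_interval cd_top; rewrite /in_interval; lia.
  pose f : hom (P k.+1) (I c d) := canonical F compat.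
  have cocf : cocycle f by move=> v; apply: (hom_outside (comp_hom (diff P k.+1) f)).
  have [g fE] := van f cocf.
  have := fE (Ordinal (top_lt _ h1)).
  rewrite (hom_outside g) // comp_lfun0l.
  by case/(ones_map_neq0 (top_in _ h1) h1).
have [h1|h1] := orP (orbN (h k.+1)); last first.
  exists (zero_hom _ _) => v; rewrite comp_lfun0l; exact: hom_outside.
have [l fE] := hom_inside f (top_lt _ h1) (top_in _ h1).
have [h0|h0] := orP (orbN (h k)).
  have compat v : (v.+1 < n)%N -> inI (syzygy_top a b k) n v -> inI c d v.+1 ->
      inI (syzygy_top a b k) n v.+1 && inI c d v.
    by move: h0 cd_interval cd_top; rewrite /in_interval; lia.
  exists (scale_hom (canonical F compat) l) => v; rewrite fE -comp_lfunZl.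
  congr (_ *: _); rewrite [RHS]ones_map_comp //.
  apply/implyP; move: h0 h1; rewrite /in_interval.
  by case: k {cond f cocf fE compat} => [|[|[|k]]] /=; 
    move: ab_interval ab_top cd_interval cd_top; rewrite /in_interval; try case: eqP; lia.
have h2 : h k.+2 by move: (cond h1); rewrite (negbTE h0).
suff l0 : l = 0 by exists (zero_hom _ _) => v; rewrite fE l0 scale0r comp_lfun0l.
have := cocf (Ordinal (top_lt _ h2)); rewrite fE -comp_lfunZl.
rewrite [X in _ *: X = _]ones_map_comp; first by apply: hom_inside_neq0 (top_in _ h2) h2.
apply/implyP => _; have := top_lt _ h2; move: ab_interval ab_top; rewrite /in_interval /=.
by case: k {h1 h2 cond f cocf fE h0} => [|[|k]] /=; try case: eqP; lia.
Qed.

Lemma exceptional_interval :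
  exceptional_pair (I c d) (I a b) <-> exceptional_cond a b c d.
Proof.
rewrite /exceptional_pair Hom_zero_interval /exceptional_cond.
have h3 k : h k.+3 = false.
  by apply/negbTE; move: cd_interval; rewrite /in_interval /=; lia.
split=> [[h0 ext0]|/and3P[h0 h1 h2]].
  apply/and3P; split=> //; first by apply/Ext_zero_interval/ext0.
  by have /Ext_zero_interval := ext0 2%N isT; rewrite h3 orbF.
split=> // -[//|[|[|k]]] _; apply/Ext_zero_interval => //.
  by rewrite h3 orbF.
by rewrite h3.
Qed.

End Criterion.

End Exceptional.

(** * Classification of the indecomposables *)

Section Classification.
Variables (F : fieldType) (n m : nat).
Hypotheses (lt_mn : (m < n)%N).
Notation Q := (linear_quiver n).
Notation modl := (module F (relation_1m n m)).
Notation I a b := (interval_module F n m a b).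
Notation inI := (in_interval m).

Lemma submodule_transport (M : modl) (U : forall v : Q, {vspace M v})
    (i j : 'I_n) (x : M i) :
  submodule U -> x \in U i -> transport M i j x \in U j.
Proof.
move=> subU xU; have [le_ij|lt_ji] := leqP i j; last first.
  by rewrite transport_gt // zero_lfunE mem0v.
rewrite -(path_transport M (linear_path le_ij)).
elim: (linear_path le_ij) x xU => [i'|i' j' k a p IH] x xU /=.
  by rewrite id_lfunE.
rewrite comp_lfunE; apply: IH; have /subvP := subU _ _ a; apply.
exact: memv_img.
Qed.

(** The generator splits along any decomposition; since the space at a is a line,
    one of its two components is itself a generator. *)
Lemma interval_indecomposable (a b : nat) :
  (a <= b < n)%N -> inI a b b -> indecomposable (I a b).
Proof.
move=> ab_interval ab_top.
have lt_an : (a < n)%N by lia.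
have aI : inI a b a by move: ab_interval ab_top; rewrite /in_interval /=; lia.
pose a' := Ordinal lt_an.
pose e : I a b a' := const_mx 1 : 'rV[F]_(inI a b a).
have es1 : entry_sum (e : 'rV[F]_(inI a b a)) = 1 by rewrite entry_sum1 aI.
split=> [/(_ a')/eqP|U W subU subW UW].
  rewrite dimv_eq0 => /eqP full0; have : e \in fullv by apply: memvf.
  rewrite full0 memv0 => /eqP e0; move: es1; rewrite e0 entry_sum0 => /esym/eqP.
  by rewrite oner_eq0.
have full (X : forall v : Q, {vspace I a b v}) (u : I a b a') :
    submodule X -> u \in X a' -> entry_sum (u : 'rV[F]_(inI a b a)) != 0 ->
    forall v, X v = fullv.
  move=> subX uX u0 v; apply/vspaceP => z; rewrite memvf.
  have [vI|vI] := orP (orbN (inI a b (v : 'I_n))); last first.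
    by rewrite [z](rV_false _ vI) mem0v.
  have le_av : (a' <= (v : 'I_n))%N by move: vI; rewrite /in_interval /=; lia.
  have := submodule_transport v subX uX.
  rewrite interval_transport // ones_mapE => uv.
  rewrite -[z](@entry_sumK F (inI a b (v : 'I_n))).
  have /(memvZ (entry_sum (z : 'rV[F]_(inI a b (v : 'I_n)))
                / entry_sum (u : 'rV[F]_(inI a b a)))) := uv.
  by rewrite scalerA divfK.
have : e \in (U a' + W a')%VS by rewrite (UW a').1 memvf.
case/memv_addP => u uU [w wW e_uw].
have [u0|u0] := eqVneq (entry_sum (u : 'rV[F]_(inI a b a))) 0; last first.
  right=> v; have [_ <-] := UW v.
  by rewrite (full U u) // capfv.
left=> v; have [_ <-] := UW v.
rewrite (full W w) ?capvf //.
have : u = entry_sum (u : 'rV[F]_(inI a b a)) *: const_mx 1 by apply/esym/entry_sumK.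
rewrite u0 scale0r => u00; move: e_uw; rewrite u00 add0r => <-.
by rewrite es1 oner_eq0.
Qed.

(** The pair (a, b) is chosen among the nonzero transports with b - a maximal, so
    that every longer transport vanishes; this is what makes U and W below
    submodules and puts U outside [a, b] equal to 0 and W equal to everything. *)
Lemma indecomposable_interval (M : modl) : indecomposable M ->
  exists a b : 'I_n, [/\ (a <= b)%N, inI a b b & isomorphic M (I a b)].
Proof.
move=> [nzM indM].
have /existsP[v0 nz_v0] : [exists v : 'I_n, \dim {: M v} != 0%N].
  apply: contraT; rewrite negb_exists => /forallP z; case: nzM => v.
  by have := z v; rewrite negbK => /eqP.
pose nz (p : 'I_n * 'I_n) := transport M p.1 p.2 != 0.
have nz0 : nz (v0, v0).
  rewrite /nz /= transport_refl; apply: contra nz_v0 => /eqP id0.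
  rewrite dimv_eq0; apply/eqP/vspaceP => x; rewrite memvf memv0; apply/esym/eqP.
  by rewrite -[x]id_lfunE id0 zero_lfunE.
pose len (p : 'I_n * 'I_n) := (p.2 - p.1)%N.
case: (@arg_maxnP _ (v0, v0) nz len nz0) => -[a b] /= nz_ab max_ab.
have le_ab : (a <= b)%N.
  by rewrite leqNgt; apply: contra nz_ab => lt_ba; rewrite /nz transport_gt.
have tr0 (i j : 'I_n) : (b - a < j - i)%N -> transport M i j = 0.
  by move=> long; apply: contraTeq long => nz_ij; rewrite -leqNgt; apply: (max_ab (i, j)).
have /lfunPn[x] := nz_ab; rewrite zero_lfunE => /=.
set y := transport M a b x => y0.
have ab_top : inI a b b.
  rewrite /in_interval le_ab leqnn /=; have [a0|//] := posnP a; rewrite /= ltnNge.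
  by apply: contra nz_ab => le_mb; rewrite /nz /= transport_relation.
(* Outside [a, b] these formulas give U = 0 and W = everything, because the
   transports occurring in them vanish there. *)
pose U (v : Q) : {vspace M v} := <[transport M a v x]>%VS.
pose W (v : Q) : {vspace M v} := (transport M v b @^-1: (<[y]>^C))%VS.
have Wmem v z : (z \in W v) = (transport M v b z \in <[y]>^C)%VS by rewrite memv_preim.
have yC c : c *: y \in (<[y]>^C)%VS -> c = 0.
  move=> cyC; have : c *: y \in (<[y]> :&: <[y]>^C)%VS by rewrite memv_cap cyC memvZ ?memv_line.
  by rewrite capv_compl memv0 scaler_eq0 (negbTE y0) orbF => /eqP.
have subU : submodule U.
  move=> i j e; rewrite limg_line -memvE -(transport_arrow _ e).
  have ej := arrow_val e; have [le_ai|lt_ia] := leqP a (i : 'I_n).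
    by rewrite transport_compE ?memv_line // le_ai ej /=.
  by rewrite (transport_gt _ lt_ia) zero_lfunE linear0 mem0v.
have subW : submodule W.
  move=> i j e; apply/subvP => _ /memv_imgP[z zW ->]; move: zW.
  rewrite !Wmem -(transport_arrow _ e).
  have ej := arrow_val e; have [le_jb|lt_bj] := leqP (j : 'I_n) b.
    by rewrite transport_compE //; move: ej le_jb => /=; lia.
  by rewrite (transport_gt _ lt_bj) zero_lfunE mem0v.
have UW (v : Q) : (U v + W v)%VS = fullv /\ (U v :&: W v)%VS = 0%VS.
  have [vI|vI] := boolP (a <= (v : 'I_n) <= b)%N.
    have yv : transport M v b (transport M a v x) = y by rewrite transport_compE.
    split; apply/vspaceP => z.
      rewrite memvf; have : transport M v b z \in (<[y]> + <[y]>^C)%VS.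
        by rewrite addv_complf memvf.
      case/memv_addP => _ /vlineP[c ->] [w wC zE].
      apply/memv_addP; exists (c *: transport M a v x); rewrite ?memvZ ?memv_line //.
      exists (z - c *: transport M a v x); last by rewrite addrC subrK.
      by rewrite Wmem linearB linearZ /= yv zE addrAC subrr add0r.
    rewrite memv_cap memv0; apply/andP/eqP => [[/vlineP[c ->]]|->].
      by rewrite Wmem linearZ /= yv => /yC ->; rewrite scale0r.
    by rewrite !mem0v.
  have [Uv Wv] : U v = 0%VS /\ W v = fullv.
    have [tav tvb] : transport M a v = 0 /\ transport M v b = 0.
      have [lt_va|le_av] := ltnP (v : 'I_n) a.
        by rewrite transport_gt // tr0 //; lia.
      by rewrite [X in _ /\ X = _]transport_gt ?tr0 //; lia.
    split; apply/vspaceP => z; first by rewrite /U tav zero_lfunE.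
    by rewrite Wmem tvb zero_lfunE mem0v memvf.
  by rewrite Uv Wv add0v cap0v.
have [U0|W0] := indM U W subU subW UW.
  have := U0 a; rewrite /U transport_refl id_lfunE => /eqP.
  rewrite -dimv_eq0 dim_vline; have [x0 _|//] := eqVneq x 0.
  by move: y0; rewrite /y x0 linear0 eqxx.
have Ufull v : U v = fullv by have [<- _] := UW v; rewrite W0 addv0.
have xv0 (v : 'I_n) : (a <= v)%N -> ~~ inI a b v -> transport M a v x = 0.
  move=> le_av; rewrite /in_interval le_av /= negb_and negb_or -!leqNgt -ltnNge.
  case/orP => [lt_bv|/andP[a0 le_mv]]; first by rewrite tr0 ?zero_lfunE //; lia.
  by rewrite transport_relation ?zero_lfunE //=; lia.
have [f fE] := interval_hom xv0.
exists a, b; split=> //; apply/isomorphic_sym/(bijective_isomorphic (f := f)) => v.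
  apply/vspaceP => z; rewrite memv_ker memv0 fE scaler_eq0.
  apply/orP/eqP => [[/eqP z0|/eqP xv]|->]; last by left; rewrite entry_sum0.
    by rewrite -[LHS](@entry_sumK F (inI a b (v : 'I_n))) z0 scale0r.
  apply: rV_false; apply: contra y0 => vI.
  rewrite /y -(@transport_compE _ _ _ M a v b) ?xv ?linear0 //.
  by move: vI; rewrite /in_interval; lia.
apply/vspaceP => z; rewrite memvf.
have : z \in U v by rewrite Ufull memvf.
case/vlineP => c ->; apply/memv_imgP.
exists (c *: const_mx 1 : 'rV[F]_(inI a b (v : 'I_n))); rewrite ?memvf // fE.
rewrite entry_sumZ entry_sum1.
have [vI|vI] := orP (orbN (inI a b (v : 'I_n))); first by rewrite vI mulr1.
have [le_av|lt_va] := leqP a (v : 'I_n); first by rewrite xv0 // !scaler0.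
by rewrite (transport_gt _ lt_va) zero_lfunE !scaler0.
Qed.

End Classification.

(** * Exceptional partners of an interval as lattice points *)

Local Open Scope nat_scope.

Section Count.

Lemma sum_range n x y : (\sum_(c < n) (x <= c < y) = minn n y - x).
Proof. by elim: n => [|n IH]; rewrite ?big_ord0 ?big_ord_recr /= ?IH; lia. Qed.

Lemma sum_box n x y z w : (y <= n) -> (w <= n) ->
  (\sum_(c < n) \sum_(d < n) ((x <= c < y) && (z <= d < w)) = (y - x) * (w - z)).
Proof.
move=> le_yn le_wn; rewrite -[in RHS](minn_idPr le_yn) -[in RHS](minn_idPr le_wn) -!sum_range.
rewrite big_distrlr /=; apply: eq_bigr => c _; apply: eq_bigr => d _.
by rewrite mulnb.
Qed.

Lemma sum_triangle n x y : (y <= n) ->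
  (\sum_(c < n) \sum_(d < n) ((x <= c <= d) && (d < y)) = 'C((y - x).+1, 2)).
Proof.
move=> le_yn; rewrite exchange_big /= -[in RHS](minn_idPr le_yn).
transitivity (\sum_(d < n) (d < y) * (d.+1 - x)).
  apply: eq_bigr => d _.
  have -> : (d.+1 - x = \sum_(c < n) (x <= c < d.+1)).
    by rewrite sum_range (minn_idPr (ltn_ord d)).
  rewrite big_distrr; apply: eq_bigr => c _ /=.
  by rewrite mulnb; congr nat_of_bool; lia.
elim: n {le_yn} => [|n IH]; first by rewrite big_ord0 min0n sub0n.
rewrite big_ord_recr /= IH; have [le_yn|lt_ny] := leqP y n.
  by rewrite mul0n addn0; congr 'C(_.+1, 2); lia.
have [le_xn|lt_nx] := leqP x n.
  have -> : (minn n.+1 y - x = (n - x).+1) by lia.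
  by rewrite [in RHS]binS bin1 mul1n; congr addn; lia.
have -> : (minn n.+1 y - x = n - x) by lia.
by rewrite mul1n (_ : (n.+1 - x = 0)) ?addn0 //; lia.
Qed.

Variables n m : nat.
Hypotheses (m_gt0 : (0 < m)) (lt_mn : (m < n)).

(** The second conjunct excludes the intervals that the relation truncates, so that
    each module I(a, b) is named once. *)
Definition is_interval a b := (a <= b) && in_interval m a b b.

(** By [exceptional_interval], this counts the first members of the exceptional
    pairs whose second member is I(a, b). *)
Definition partner_count a b : nat :=
  \sum_(c < n) \sum_(d < n) (is_interval c d && exceptional_cond n m a b c d).

(** The tops are 0, b + 1 and m. An interval avoiding all three lies in one of the
    gaps, which gives the triangles; otherwise it meets exactly {0, b + 1} or
    {b + 1, m}, which gives the last two terms. *)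
Lemma partner_indicator0 b c d : (b < m) -> (d < n) ->
  (is_interval c d && exceptional_cond n m 0 b c d =
    ((0 < c <= d) && (d < b.+1)) + ((b.+1 < c <= d) && (d < m))
    + ((m < c <= d) && (d < n)) + ((0 <= c < 1) && (b.+1 <= d < m))
    + ((0 < c < b.+2) && (m <= d < n)) :> nat).
Proof.
move=> lt_bm lt_dn.
rewrite /is_interval /exceptional_cond /in_interval /= lt_dn leqnn !andbT m_gt0.
have [->|c_gt0] := posnP c; rewrite /= ?ltnn ?orbF ?andbT; first lia.
have -> : (c < 1) = false by lia.
have -> : (c <= 0) = false by lia.
rewrite /= addn0 andbb.
have [le_cd|lt_dc] := leqP c d => /=; last lia.
by have [? /=|? /=] := leqP d b; have [? /=|? /=] := leqP c b.+1;
   have [? /=|? /=] := leqP c m; have [? /=|? /=] := leqP m d; lia.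
Qed.

(** The tops are a and b + 1, to be both met or both avoided. Meeting both: c > 0,
    then c = 0, where d < m. Avoiding both to the left of a: again c > 0, then
    c = 0; then between a and b + 1, and to the right of b + 1. *)
Lemma partner_indicatorS a b c d : (0 < a <= b) -> (b < n) -> (d < n) ->
  (is_interval c d && exceptional_cond n m a b c d =
    ((1 <= c < a.+1) && (b.+1 <= d < n)) + ((0 <= c < 1) && (b.+1 <= d < m))
    + ((1 <= c <= d) && (d < a)) + ((0 <= c < 1) && (0 <= d < minn a m))
    + ((a < c <= d) && (d < b.+1)) + ((b.+1 < c <= d) && (d < n)) :> nat).
Proof.
move=> /andP[a_gt0 le_ab] lt_bn lt_dn.
rewrite /is_interval /exceptional_cond /in_interval /= lt_dn leqnn !andbT.
have -> : (a == 0) = false by lia.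
have -> : (n <= d) = false by lia.
have [->|c_gt0] := posnP c; rewrite /= ?ltnn ?orbF ?andbT ?andbF.
  by have [? /=|? /=] := leqP a d; have [? /=|? /=] := leqP m d;
     have [? /=|? /=] := ltnP b d; lia.
have -> : (c < 1) = false by lia.
rewrite /= !addn0 andbb.
have [le_cd|lt_dc] := leqP c d => /=; last lia.
by have [? /=|? /=] := leqP a d; have [? /=|? /=] := ltnP b d;
   have [? /=|? /=] := leqP c a; have [? /=|? /=] := leqP c b.+1; lia.
Qed.

Lemma partner_count0E b : (b < m) ->
  partner_count 0 b = ('C(b.+1, 2) + 'C(m - b.+1, 2) + 'C(n - m, 2)
            + (m - b.+1) + b.+1 * (n - m)).
Proof.
move=> lt_bm.
(* The summands of [partner_indicator0], in the shape in which the lemmas on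
   triangles and rectangles produce them. *)
transitivity ('C((b.+1 - 1).+1, 2) + 'C((m - b.+2).+1, 2) + 'C((n - m.+1).+1, 2)
            + (1 - 0) * (m - b.+1) + (b.+2 - 1) * (n - m)); last first.
  have -> : 'C((m - b.+2).+1, 2) = 'C(m - b.+1, 2).
    by have [->|ne] := eqVneq m b.+1; [rewrite subnn subnS subnn | congr 'C(_, 2); lia].
  have -> : ((n - m.+1).+1 = n - m) by lia.
  by rewrite !subSS !subn0 mul1n.
rewrite -!(@sum_triangle n) -?(@sum_box n) -?big_split; try lia.
apply: eq_bigr => c _; rewrite -!big_split; apply: eq_bigr => d _ /=.
by rewrite partner_indicator0.
Qed.

Lemma partner_countSE a b : (0 < a <= b) -> (b < n) ->
  partner_count a b = (a * (n - b.+1) + (m - b.+1) + 'C(a, 2) + minn a m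
             + 'C((b - a).+1, 2) + 'C(n - b.+1, 2)).
Proof.
move=> le_ab lt_bn.
transitivity ((a.+1 - 1) * (n - b.+1) + (1 - 0) * (m - b.+1) + 'C((a - 1).+1, 2)
   + (1 - 0) * (minn a m - 0) + 'C((b.+1 - a.+1).+1, 2) + 'C((n - b.+2).+1, 2)); last first.
  have -> : 'C((n - b.+2).+1, 2) = 'C(n - b.+1, 2).
    by have [->|ne] := eqVneq n b.+1; [rewrite subnn subnS subnn | congr 'C(_, 2); lia].
  have -> : ((a - 1).+1 = a) by lia.
  by rewrite !subSS !subn0 !mul1n.
rewrite -!(@sum_triangle n) -?(@sum_box n) -?big_split; try lia.
apply: eq_bigr => c _; rewrite -!big_split; apply: eq_bigr => d _ /=.
by rewrite partner_indicatorS.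
Qed.

End Count.

Local Open Scope ring_scope.

(** * Summation *)

(** Discrete fundamental theorem of calculus; it reduces each summation below to
    a polynomial identity. *)
Lemma sum_antidifference k (g : 'I_k -> rat) (S : rat -> rat) :
  S 0 = 0 -> (forall i : 'I_k, S (i%:R + 1) = S i%:R + g i) ->
  \sum_(i < k) g i = S k%:R.
Proof.
move=> S0 step; rewrite -[RHS]subr0 -[X in _ - X]S0.
rewrite -(telescope_sumr (fun i => S i%:R) (leq0n k)) big_mkord.
by apply: eq_bigr => i _; rewrite -natr1 step addrC addKr.
Qed.

Lemma bin2_rat k : ('C(k, 2))%:R = k%:R * (k%:R - 1) / 2 :> rat.
Proof.
elim: k => [|k IH]; first by rewrite bin0n !mulr0n !mul0r.
by rewrite binS bin1 natrD IH -natr1; field.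
Qed.

Lemma bin3_rat k : ('C(k, 3))%:R = k%:R * (k%:R - 1) * (k%:R - 2) / 6 :> rat.
Proof.
elim: k => [|k IH]; first by rewrite bin0n !mulr0n !mul0r.
by rewrite binS natrD IH bin2_rat -natr1; field.
Qed.

Section Total.
Variables n m : nat.
Hypotheses (m_gt0 : (0 < m)%N) (lt_mn : (m < n)%N).
Notation N := (n%:R : rat).
Notation K := (m%:R : rat).

Lemma sum_minn b : (\sum_(i < b) minn i.+1 m + 'C((b - m).+1, 2) = 'C(b.+1, 2))%N.
Proof.
elim: b => [|b IH]; first by rewrite big_ord0 sub0n.
rewrite big_ord_recr /= [in RHS]binS bin1 -IH.
have [le_mb|lt_bm] := leqP m b.
  rewrite subSn // [in LHS]binS bin1 (minn_idPr (leqW le_mb)).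
  by move: (\sum_(i < b) _)%N ('C(_, 2)) => s c; lia.
have -> : (b.+1 - m = b - m)%N by lia.
rewrite (minn_idPl lt_bm); move: (\sum_(i < b) _)%N ('C(_, 2)) => s c; lia.
Qed.

Lemma sum_bin2_sub k : (\sum_(b < k) 'C((b - m).+1, 2) = 'C((k - m).+1, 3))%N.
Proof.
elim: k => [|k IH]; first by rewrite big_ord0 sub0n.
rewrite big_ord_recr /= IH; have [le_mk|lt_km] := leqP m k.
  by rewrite subSn // [in RHS]binS.
by rewrite (_ : k.+1 - m = k - m)%N; [rewrite (_ : k - m = 0)%N //; lia | lia].
Qed.

(** The contribution of the modules I(a, b) with a > 0, for fixed b. The two
    truncated terms are left aside: they are not polynomial in b on the whole
    range, and are summed separately. *)
Lemma columnE b : (b < n)%N ->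
  (\sum_(i < b) partner_count n m i.+1 b)%:R =
    1 / 3 * b%:R ^+ 3 + (2 - N) / 2 * b%:R ^+ 2
    + ((N - 1) / 2 - 1 / 3 + (N - 1) * (N - 2) / 2 + 1 / 2) * b%:R
    + (b * (m - b.+1))%:R - ('C((b - m).+1, 2))%:R :> rat.
Proof.
move=> lt_bn.
have -> : (\sum_(i < b) partner_count n m i.+1 b = \sum_(i < b) (i.+1 * (n - b.+1) + 'C(i.+1, 2)
    + 'C(b - i, 2) + 'C(n - b.+1, 2)) + \sum_(i < b) minn i.+1 m + b * (m - b.+1))%N.
  have -> : (b * (m - b.+1) = \sum_(i < b) (m - b.+1))%N by rewrite sum_nat_const card_ord.
  rewrite -!big_split; apply: eq_bigr => i _ /=.
  by rewrite partner_countSE //; [rewrite (_ : (b - i.+1).+1 = b - i)%N|]; have := ltn_ord i; lia.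
rewrite natrD [X in X + _ = _]natrD; have /(congr1 (fun k => k%:R : rat)) := sum_minn b.
rewrite natrD => /(canRL (addrK _)) ->.
rewrite natr_sum (sum_antidifference (S := fun x => (N - b%:R - 1) * (x * (x + 1) / 2)
   + (x - 1) * x * (x + 1) / 6
   + ((b%:R + 1) * b%:R * (b%:R - 1) - (b%:R - x + 1) * (b%:R - x) * (b%:R - x - 1)) / 6
   + x * (N - b%:R - 1) * (N - b%:R - 2) / 2)).
- by rewrite (bin2_rat b.+1) -(natr1 b); field.
- by field.
- move=> i; have lt_ib := ltn_ord i; rewrite 3!natrD natrM !bin2_rat !natrB //; try lia.
  by rewrite -!natr1; field.
Qed.

(** Joining the truncated term of [columnE] to the intervals that start at 0
    cancels the quadratic terms in b. *)
Lemma column0E b : (b < m)%N ->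
  (partner_count n m 0 b + b * (m - b.+1))%:R =
  (N - K) * b%:R + (K - 1) * K / 2 + (N - K) * (N - K + 1) / 2.
Proof.
move=> lt_bm; rewrite partner_count0E // 5!natrD !natrM !bin2_rat !natrB //; try lia.
by rewrite -!natr1; field.
Qed.

Lemma total_split :
  (\sum_(a < n) \sum_(b < n) is_interval m a b * partner_count n m a b =
   \sum_(b < m) partner_count n m 0 b + \sum_(b < n) \sum_(i < b) partner_count n m i.+1 b)%N.
Proof.
rewrite exchange_big /= (big_ord_widen n (partner_count n m 0)) 1?ltnW //.
rewrite [X in _ = (X + _)%N]big_mkcond -big_split.
apply: eq_bigr => b _ /=; case: n lt_mn b => [//|n' lt_mn' b].
rewrite big_ord_recl; congr addn.
  by rewrite /is_interval /in_interval /= leqnn; case: (b < m)%N; rewrite ?mul1n.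
have le_bn' : (b <= n')%N by rewrite -ltnS.
rewrite (big_ord_widen _ (fun i => partner_count n'.+1 m i.+1 b) le_bn') [RHS]big_mkcond.
apply: eq_bigr => i _; rewrite /is_interval /in_interval /= leqnn andbT.
by case: (i < b)%N; rewrite ?mul1n ?mul0n.
Qed.

Lemma total_rat :
  (\sum_(a < n) \sum_(b < n) is_interval m a b * partner_count n m a b)%:R =
  1 / 6 * (4 * K ^+ 3 - 3 * K ^+ 2 * (2 * N + 1) + K * (6 * N ^+ 2 - 1)
           + (N - 2) * (N - 1) * N ^+ 2) :> rat.
Proof.
rewrite total_split natrD [X in _ + X]natr_sum (eq_bigr _ (fun b _ => columnE (ltn_ord b))).
rewrite sumrB big_split /= -!natr_sum sum_bin2_sub.
rewrite (sum_antidifference (S := fun x =>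
    1 / 3 * (x * (x - 1) / 2) ^+ 2 + (2 - N) / 2 * ((x - 1) * x * (2 * x - 1) / 6)
    + ((N - 1) / 2 - 1 / 3 + (N - 1) * (N - 2) / 2 + 1 / 2) * (x * (x - 1) / 2)));
  [|by field|by move=> i; field].
have -> : (\sum_(b < n) b * (m - b.+1) = \sum_(b < m) b * (m - b.+1))%N.
  rewrite [RHS](big_ord_widen n (fun b => b * (m - b.+1))%N) 1?ltnW // [RHS]big_mkcond.
  apply: eq_bigr => b _; case: ltnP => // le_mb.
  by rewrite (_ : m - b.+1 = 0)%N ?muln0 //; lia.
rewrite bin3_rat -(natr1 (n - m)) natrB 1?ltnW //.
have low : \sum_(b < m) ((partner_count n m 0 b + b * (m - b.+1))%N)%:R =
    (N - K) * (K * (K - 1) / 2) + K * ((K - 1) * K / 2 + (N - K) * (N - K + 1) / 2).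
  rewrite (eq_bigr _ (fun b _ => column0E (ltn_ord b))).
  rewrite (sum_antidifference (S := fun x => (N - K) * (x * (x - 1) / 2)
     + x * ((K - 1) * K / 2 + (N - K) * (N - K + 1) / 2))) //; first by field.
  by move=> i; field.
move: low; rewrite -natr_sum big_split /= natrD => /(canRL (addrK _)) ->.
by field.
Qed.

End Total.

(** * Exceptional pairs *)

Section Enumeration.
Variables (F : fieldType) (n m : nat).
Hypotheses (m_gt0 : (0 < m)%N) (lt_mn : (m < n)%N).
Notation I a b := (interval_module F n m a b).

(** Pairs ((a, b), (c, d)) for the exceptional pair (I(c, d), I(a, b)), so that the
    outer sum runs over the module that is resolved. *)
Definition exceptional_indices : {set ('I_n * 'I_n) * ('I_n * 'I_n)} :=
  [set p : ('I_n * 'I_n) * ('I_n * 'I_n) | is_interval m p.1.1 p.1.2 &&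
    (is_interval m p.2.1 p.2.2 && exceptional_cond n m p.1.1 p.1.2 p.2.1 p.2.2)].

Lemma card_exceptional_indices :
  #|exceptional_indices| =
  (\sum_(a < n) \sum_(b < n) is_interval m a b * partner_count n m a b)%N.
Proof.
rewrite cardsE -sum1_card big_mkcond.
rewrite -(pair_bigA _ (fun x y : 'I_n * 'I_n =>
  (is_interval m x.1 x.2 && (is_interval m y.1 y.2
     && exceptional_cond n m x.1 x.2 y.1 y.2)) : nat)) /=.
rewrite -(pair_bigA _ (fun a b : 'I_n => \sum_(y : 'I_n * 'I_n)
  (is_interval m a b && (is_interval m y.1 y.2 && exceptional_cond n m a b y.1 y.2) : nat)))%N /=.
apply: eq_bigr => a _; apply: eq_bigr => b _.
rewrite -(pair_bigA _ (fun c d : 'I_n =>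
  (is_interval m a b && (is_interval m c d && exceptional_cond n m a b c d)) : nat)) /=.
rewrite big_distrr; apply: eq_bigr => c _; rewrite big_distrr; apply: eq_bigr => d _ /=.
by rewrite mulnb.
Qed.

Lemma is_interval_bounds (a b : 'I_n) : is_interval m a b -> (a <= b < n)%N /\ in_interval m a b b.
Proof. by case/andP => le_ab top; rewrite le_ab ltn_ord. Qed.

Lemma interval_inj (a b a' b' : 'I_n) : is_interval m a b -> is_interval m a' b' ->
  isomorphic (I a b) (I a' b') -> (a, b) = (a', b').
Proof.
rewrite /is_interval => /andP[le_ab top] /andP[le_ab' top'] iso.
have inE v := interval_isomorphic v iso.
have := (inE a, inE b, inE a', inE b'); move: top top'; rewrite /in_interval.
move=> top top' [[[ia ib] ia'] ib'].
by congr (_, _); apply: val_inj => /=; lia.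
Qed.

Lemma number_of_exceptional_indices :
  number_of_exceptional_pairs F (relation_1m n m) #|exceptional_indices|.
Proof.
exists (fun i : 'I_#|exceptional_indices| =>
  let p := enum_val i in (I p.2.1 p.2.2, I p.1.1 p.1.2)); split=> /=.
- move=> i; have := enum_valP i; rewrite inE.
  move=> /and3P[/is_interval_bounds[ab abt] /is_interval_bounds[cd cdt] ex].
  by split; [exact: interval_indecomposable|exact: interval_indecomposable|
             exact/exceptional_interval].
- move=> i j isoM isoN; apply: enum_val_inj.
  have := enum_valP i; have := enum_valP j; rewrite !inE => /and3P[vj vj' _] /and3P[vi vi' _].
  move: (interval_inj vi vj isoN) (interval_inj vi' vj' isoM).
  by rewrite -!surjective_pairing => eN eM; apply/eqP; rewrite /eq_op /= eN eM !eqxx.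
- move=> M N /(indecomposable_interval lt_mn)[c [d [le_cd cdt isoM]]].
  move=> /(indecomposable_interval lt_mn)[a [b [le_ab abt isoN]]] ex.
  have pS : ((a, b), (c, d)) \in exceptional_indices.
    rewrite inE /= /is_interval le_ab abt le_cd cdt /=.
    by apply/(exceptional_interval F m_gt0 lt_mn); rewrite ?le_ab ?le_cd ?ltn_ord //;
       apply: exceptional_pair_iso ex.
  by exists (enum_rank_in pS ((a, b), (c, d))); rewrite enum_rankK_in.
Qed.

End Enumeration.

Theorem corollary4p6 (F : closedFieldType) (n m : nat)
    (hn : (3 <= n)%N) (hm2 : (2 <= m)%N) (hmn : (m <= n - 1)%N) :
  exists k : nat,
    number_of_exceptional_pairs F (relation_1m n m) k /\
    k%:R = 1 / 6 * (4 * m%:R ^+ 3 - 3 * m%:R ^+ 2 * (2 * n%:R + 1)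
                    + m%:R * (6 * n%:R ^+ 2 - 1)
                    + (n%:R - 2) * (n%:R - 1) * n%:R ^+ 2) :> rat.
Proof.
have m_gt0 : (0 < m)%N by lia.
have lt_mn : (m < n)%N by lia.
exists #|exceptional_indices n m|; split; first exact: number_of_exceptional_indices.
by rewrite card_exceptional_indices total_rat.
Qed.
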